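(* Consider a system with a finite set $S$ of tasks, periods $\tau_X$, frame length $T=\mathrm{lcm}\{\tau_X : X\in S\}$, per-execution rewards $r^1_X\ge r^2_X\ge\dots\ge r^{\tau_X}_X\ge 0$ and minimum average reward requirements $q^*_X>0$ (as in the context). The system is feasible if and only if there exist real numbers $\{f^i_X : X\in S,\ 1\le i\le\tau_X\}$ such that (1) $q^*_X\le \sum_{i=1}^{\tau_X} f^i_X r^i_X$ for all $X\in S$; (2) $0\le f^i_X\le T/\tau_X$ for all $X\in S$ and $1\le i\le\tau_X$; (3) $\sum_{X\in S}\sum_{i=1}^{\tau_X} f^i_X\le T$.
   Context: A system consists of a finite set $S$ of tasks. Time is slotted, $t\in\{0,1,2,\dots\}$. Each task $X\in S$ has a period $\tau_X$ (a positive integer); time is partitioned into consecutive periods of $X$ of $\tau_X$ slots each, the first starting at $t=0$. In each period, task $X$ has one job, which is removed from the system at the end of that period. Let $T$ be the least common multiple of $\{\tau_X : X\in S\}$; time is partitioned into consecutive frames of $T$ slots each, the first starting at $t=0$. A scheduling policy (possibly randomized, possibly history dependent) chooses in each time slot either to idle or to execute the job of exactly one task; a job may be executed in any number of slots within its period. Each task $X$ has rewards $r^1_X\ge r^2_X\ge\dots\ge r^{\tau_X}_X\ge 0$: when the job of $X$ is executed for the $i$-th time within a period, $X$ obtains reward $r^i_X$. Let $s_X(t)$ be the total reward obtained by $X$ between time $0$ and time $t$; the average reward of $X$ is $q_X=\liminf_{t\to\infty} s_X(t)/(t/T)$. Each task has a minimum average reward requirement $q^*_X>0$. A policy fulfills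 the system if under it $q_X\ge q^*_X$ with probability 1 for all $X\in S$. The system is feasible if some scheduling policy fulfills it. *)

(* Defs.v *)
From HB Require Import structures.
From mathcomp Require Import all_boot all_order all_algebra.
From mathcomp Require Import all_classical all_reals all_analysis.
Set Implicit Arguments. Unset Strict Implicit. Unset Printing Implicit Defensive.
Import Order.TTheory GRing.Theory Num.Theory.
Local Open Scope ring_scope.
Local Open Scope classical_set_scope.

Section Sched.
Variables (R : realType) (S : finType).

Definition frame (tau : S -> nat) : nat := \big[lcmn/1%N]_(X : S) tau X.

(* A schedule: in slot t, [None] = idle, [Some X] = execute the job of X. *)
Definition exec_count (tau : S -> nat) (sched : nat -> option S) (X : S) (u : nat)
  : nat :=
  (\sum_((u %/ tau X) * tau X <= v < u.+1) (sched v == Some X))%N.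

(* s_X(t): total reward obtained by X in slots 0 .. t-1; the i-th execution
   within a period earns r X i (rewards indexed from 1). *)
Definition total_reward (tau : S -> nat) (r : S -> nat -> R)
  (sched : nat -> option S) (X : S) (t : nat) : R :=
  \sum_(0 <= u < t | sched u == Some X) r X (exec_count tau sched X u).

Definition avg_reward (tau : S -> nat) (r : S -> nat -> R)
  (sched : nat -> option S) (X : S) : \bar R :=
  limn_einf (fun t : nat =>
    (total_reward tau r sched X t / (t%:R / (frame tau)%:R))%:E).

(* A (possibly randomized, history dependent) scheduling policy is modelled
   by the random schedule it generates on some probability space. *)
Definition fulfills (tau : S -> nat) (r : S -> nat -> R) (qstar : S -> R)
  {d : measure_display} {Omega : measurableType d}
  (P : probability Omega R) (sigma : Omega -> nat -> option S) : Prop :=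
  (forall (t : nat) (a : option S), measurable [set w | sigma w t = a]) /\
  {ae P, forall w, forall X : S, ((qstar X)%:E <= avg_reward tau r (sigma w) X)%E}.

Definition feasible (tau : S -> nat) (r : S -> nat -> R) (qstar : S -> R)
  : Prop :=
  exists (d : measure_display) (Omega : measurableType d)
         (P : probability Omega R) (sigma : Omega -> nat -> option S),
    fulfills tau r qstar P sigma.

End Sched.

(* Main.v *)
Require Import Defs.
From HB Require Import structures.
From mathcomp Require Import all_boot all_order all_algebra.
From mathcomp Require Import all_classical all_reals all_analysis.
From mathcomp Require Import ring lra zify.
Set Implicit Arguments. Unset Strict Implicit. Unset Printing Implicit Defensive.
Import Order.TTheory GRing.Theory Num.Theory.
Import numFieldNormedType.Exports.
Local Open Scope ring_scope.

(** Necessity: along an almost sure schedule, let [F n X i] be the number of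
    periods of [X] in the first [n.+1] frames containing at least [i]
    executions, divided by [n.+1].  Each [F n] satisfies (2) and (3), and
    [\sum_i F n X i * r X i] is the reward of [X] per frame; an ultrafilter
    limit of the [F n] is the required [f].

    Sufficiency: a deterministic schedule works.  By Blackwell's approachability
    argument it suffices that, for all weights [d >= 0], some schedule of a
    single frame has [d]-weighted reward at least [\sum_X d X * q X], where
    [q X = \sum_i f X i * r X i].  Giving [X] in each slot the fraction
    [\sum_i f X i / T] of the slot is a fractional solution of the
    transportation problem between slots and periods with that value, and this
    problem has an integral optimum; the rewards being nonincreasing, an integral
    solution may fill the executions of each period in order. *)

(** * Integral optima of a transportation problem with concave node values *)

Section Assignment.
Variables (R : realFieldType) (I V : finType) (e : I -> V -> bool).
Variable w : V -> nat -> R.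
Hypothesis w_ge0 : forall v i, 0 <= w v i.
Hypothesis w_noninc : forall v i j, (i <= j)%N -> w v j <= w v i.

Implicit Types (s : {ffun I -> V}) (u v : V) (t : I).

Definition load s v : nat := (\sum_t (s t == v))%N.
Definition valid s : bool := [forall t, e t (s t)].
Definition value s : R := \sum_v \sum_(i < load s v) w v i.

Definition reassign s t v : {ffun I -> V} :=
  [ffun t' => if t' == t then v else s t'].

(** The exchange graph of [s]: along a path from [u] to [v], each node takes a slot from the next,
    so [u] gains a unit and [v] loses one. *)
Definition steals s : rel V := fun u v => [exists t, e t u && (s t == v)].

Lemma load_reassign s t v x :
  (load (reassign s t v) x + (x == s t) = load s x + (x == v))%N.
Proof.
rewrite /load (bigD1 t) //= [in RHS](bigD1 t) //= ffunE eqxx.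
rewrite (eq_bigr (fun t' => (s t' == x) : nat)); last first.
  by move=> t' /negbTE nt; rewrite ffunE nt.
by rewrite [s t == x]eq_sym [v == x]eq_sym; lia.
Qed.

Lemma valid_reassign s t v : valid s -> e t v -> valid (reassign s t v).
Proof.
move=> /forallP vs etv; apply/forallP => t'; rewrite ffunE.
by case: eqP => [->|].
Qed.

(** Perform the first exchange and recurse. It moves only a slot held by the second node, which
    never recurs on a duplicate-free path, so the later edges survive. *)
Lemma transfer_along_path s u p :
    valid s -> path (steals s) u p -> uniq (u :: p) ->
  exists2 s', valid s' &
    forall v, (load s' v + (v == last u p) = load s v + (v == u))%N.
Proof.
elim: p s u => [|v p IHp] s u vs /=; first by exists s.
case/andP=> /existsP[t /andP[etu /eqP stv]] pth /andP[u_notin uniq_vp].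
have [||s' vs' ls'] := IHp (reassign s t u) v _ _ uniq_vp.
- exact: valid_reassign.
- have {uniq_vp u_notin} : v \notin p by case/andP: uniq_vp.
  elim: p {-2}v pth {IHp} => //= x p IHp y /andP[/existsP[t' /andP[et'y st'x]] pth].
  rewrite inE negb_or => /andP[vx v_notin]; rewrite IHp // andbT.
  apply/existsP; exists t'; rewrite et'y ffunE (negbTE (_ : t' != t)) //=.
  by apply: contra vx => /eqP t't; rewrite -stv -t't.
exists s' => // x; have := ls' x; have := load_reassign s t u x.
by rewrite stv; lia.
Qed.

(** Otherwise shifting one unit along a simple path from [u] to [v] would improve an optimal
    assignment. *)
Lemma gain_le_loss s u v : valid s ->
    (forall s', valid s' -> value s' <= value s) ->
    connect (steals s) u v -> (0 < load s v)%N ->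
  w u (load s u) <= w v (load s v).-1.
Proof.
move=> vs smax /connectP[p0 pth0 ->].
case/shortenP: pth0 => p pth up _ {p0}.
have [s' vs' ls'] := transfer_along_path vs pth up.
move: (last u p) ls' => {up pth}x ls' lx.
have [<-|ux] := eqVneq u x; first by apply: w_noninc; lia.
have := smax s' vs'; rewrite /value (bigD1 u) //= (bigD1 x) 1?eq_sym //=.
rewrite [in leRHS](bigD1 u) //= [in leRHS](bigD1 x) 1?eq_sym //=.
rewrite (eq_bigr (fun v => \sum_(i < load s v) w v i)); last first.
  move=> v' /andP[/negbTE v'u /negbTE v'x].
  by have := ls' v'; rewrite v'u v'x !addn0 => ->.
have := ls' u; rewrite (negbTE ux) eqxx addn0 addn1 => ->.
have := ls' x; rewrite eq_sym in ux; rewrite (negbTE ux) eqxx addn0 addn1 => lx'.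
rewrite -lx' /= !big_ord_recr /=; lra.
Qed.

(* [x t v] is the fraction of slot [t] given to node [v], and [z v i] the part of
   the [i]-th unit of [v] that is filled.  At an optimal assignment, let the price
   of [v] be the largest marginal gain among the nodes from which [v] can be
   reached in the exchange graph.  Prices are nondecreasing along exchanges and
   separate the weights of the units held by [v] from the others, so they form an
   optimal solution of the dual linear program. *)
Lemma assignment_integrality (m : nat) (z : V -> nat -> R) (x : I -> V -> R) s0 :
    valid s0 -> (#|I| <= m)%N ->
    (forall v i, 0 <= z v i <= 1) ->
    (forall t v, 0 <= x t v) -> (forall t v, ~~ e t v -> x t v = 0) ->
    (forall t, \sum_v x t v <= 1) ->
    (forall v, \sum_t x t v = \sum_(i < m) z v i) ->
  exists2 s, valid s & \sum_v \sum_(i < m) z v i * w v i <= value s.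
Proof.
move=> vs0 Im z01 x_ge0 x_supp x_le1 xz.
case: (@Order.TotalTheory.arg_maxP _ _ _ s0 valid value vs0) => s vs smax.
exists s => //.
pose A v := \big[Num.max/0]_(u | connect (steals s) u v) w u (load s u).
have A_ge0 v : 0 <= A v by exact: bigmax_ge_id.
have A_gain v : w v (load s v) <= A v by apply: le_bigmax_cond; exact: connect0.
have A_loss v : (0 < load s v)%N -> A v <= w v (load s v).-1.
  move=> lv; apply: bigmax_le => // u uv; exact: gain_le_loss.
have A_mono t v : e t v -> A v <= A (s t).
  move=> etv; apply: bigmax_le => // u uv; apply: le_bigmax_cond.
  by apply: connect_trans uv (connect1 _); apply/existsP; exists t; rewrite etv /=.
have lm v : (load s v <= m)%N.
  by apply: leq_trans Im; rewrite -sum1_card; apply: leq_sum => t _; case: eqP.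
(* The reduced weights [w v i - A v] are nonnegative below the load and nonpositive from it on, so
   with [z v i] in [0, 1] the best choice is 1 and then 0. *)
have node v : \sum_(i < m) z v i * (w v i - A v) <=
              \sum_(i < load s v) (w v i - A v).
  rewrite -(big_mkord xpredT (fun i => z v i * (w v i - A v))).
  rewrite -(big_mkord xpredT (fun i => w v i - A v)).
  rewrite (@big_cat_nat _ _ _ (load s v)) //=.
  rewrite -[leRHS]addr0; apply: lerD.
    apply: ler_sum_nat => i /andP[_ il]; have /andP[z0 z1] := z01 v i.
    apply: ler_piMl => //; rewrite subr_ge0.
    apply: le_trans (A_loss v _) _; first exact: leq_ltn_trans il.
    by apply: w_noninc; lia.
  rewrite big_nat; apply: sumr_le0 => i /andP[li _]; have /andP[z0 z1] := z01 v i.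
  apply: mulr_ge0_le0 => //; rewrite subr_le0.
  by apply: le_trans (A_gain v); exact: w_noninc.
(* Summed slot by slot: slot [t] pays at most [A (s t)] to each node it may serve, and its fractions
   add up to at most 1. *)
have prices : \sum_v \sum_(i < m) z v i * A v <= \sum_v \sum_(i < load s v) A v.
  under eq_bigr => v _ do rewrite -mulr_suml -xz mulr_suml.
  rewrite exchange_big /=.
  under [leRHS]eq_bigr => v _ do rewrite sumr_const card_ord /load -sumrMnr.
  rewrite [leRHS]exchange_big /=; apply: ler_sum => t _.
  rewrite [leRHS](bigD1 (s t)) //= eqxx [X in _ <= _ + X]big1 ?addr0; last first.
    by move=> v; rewrite eq_sym => /negbTE ->.
  apply: (@le_trans _ _ (\sum_v x t v * A (s t))).
    apply: ler_sum => v _; have [etv|/x_supp ->] := boolP (e t v); last by rewrite !mul0r.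
    by apply: ler_wpM2l => //; exact: A_mono.
  by rewrite -mulr_suml; apply: ler_piMl.
have : \sum_v \sum_(i < m) z v i * (w v i - A v) <=
       \sum_v \sum_(i < load s v) (w v i - A v) by apply: ler_sum => v _.
rewrite (eq_bigr (fun v => \sum_(i < m) z v i * w v i - \sum_(i < m) z v i * A v)); last first.
  by move=> v _; rewrite -sumrB; apply: eq_bigr => i _; rewrite mulrBr.
rewrite [leRHS](eq_bigr (fun v => \sum_(i < load s v) w v i - \sum_(i < load s v) A v)); last first.
  by move=> v _; rewrite -sumrB.
rewrite !sumrB => le1; rewrite /value; lra.
Qed.
End Assignment.

(** * Rewards counted by periods, and optimal schedules of one frame *)

Lemma sum_by_rank (V : nmodType) (g : nat -> V) (b : pred nat) (a m : nat) :
  \sum_(a <= u < a + m | b u) g (\sum_(a <= v < u.+1) b v)%N =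
  \sum_(1 <= i < (\sum_(a <= v < a + m) b v)%N.+1) g i.
Proof.
elim: m => [|m IHm]; first by rewrite addn0 !big_geq.
rewrite addnS big_mkcond big_nat_recr ?leq_addr //= -big_mkcond IHm.
have -> : (\sum_(a <= v < (a + m).+1) b v = \sum_(a <= v < a + m) b v + b (a + m))%N.
  by rewrite big_nat_recr ?leq_addr.
case: (b (a + m)%N); last by rewrite addn0 addr0.
by rewrite addn1 [in RHS]big_nat_recr.
Qed.

Lemma sum_pad (V : nmodType) (g : nat -> V) (n m : nat) : (n <= m)%N ->
  \sum_(0 <= i < m) (if (i < n)%N then g i else 0) = \sum_(0 <= i < n) g i.
Proof.
move=> nm; rewrite -big_mkcond /= [RHS](big_nat_widen _ _ m) //.
Qed.

Section Frames.
Variables (R : realType) (S : finType) (tau : S -> nat) (r : S -> nat -> R).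
Hypothesis tau_pos : forall X, (0 < tau X)%N.
Implicit Types (sched : nat -> option S) (X : S).

Definition executions sched X k : nat :=
  (\sum_(k * tau X <= v < k.+1 * tau X) (sched v == Some X))%N.

Lemma executions_le sched X k : (executions sched X k <= tau X)%N.
Proof.
apply: leq_trans (_ : \sum_(k * tau X <= v < k.+1 * tau X) 1 <= _)%N.
  by apply: leq_sum => v _; case: eqP.
by rewrite sum_nat_const_nat muln1 mulSn addnK.
Qed.

Lemma total_reward_periods sched X K :
  total_reward tau r sched X (K * tau X) =
  \sum_(0 <= k < K) \sum_(1 <= i < (executions sched X k).+1) r X i.
Proof.
elim: K => [|K IHK]; first by rewrite /total_reward !big_geq.
rewrite [RHS]big_nat_recr //= -IHK /total_reward.
rewrite (@big_cat_nat _ _ _ (K * tau X)) //=; last by rewrite leq_mul2r leqnSn orbT.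
(* Within a period the executions have ranks 1, 2, and so on, so only their number matters. *)
congr (_ + _); rewrite /executions mulSnr -sum_by_rank.
rewrite big_nat_cond [RHS]big_nat_cond; apply: eq_bigr => u /andP[/andP[Ku uK] _].
congr (r X _); rewrite /exec_count.
suff -> : (u %/ tau X = K)%N by [].
by rewrite -(subnKC Ku) divnMDl // divn_small ?addn0 // ltn_subLR // addnC.
Qed.

Lemma eq_total_reward sched sched' X t :
  (forall v, (v < t)%N -> sched v = sched' v) ->
  total_reward tau r sched X t = total_reward tau r sched' X t.
Proof.
move=> eqs; rewrite /total_reward big_nat_cond [RHS]big_nat_cond.
apply: eq_big => [u|u /andP[/andP[_ ut] _]].
  by case: ltnP => //= ut; rewrite eqs.
congr (r X _); apply: eq_big_nat => v /andP[_ vu]; rewrite eqs //.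
exact: leq_trans ut.
Qed.

(** A shift by a multiple of [tau X] maps periods onto periods and so preserves the ranks of
    executions. *)
Lemma total_reward_shift sched X a t : (tau X %| a)%N ->
  total_reward tau r sched X (a + t) =
  total_reward tau r sched X a + total_reward tau r (fun v => sched (a + v)%N) X t.
Proof.
move=> /dvdnP[b ->]; rewrite /total_reward (@big_cat_nat _ _ _ (b * tau X)) ?leq_addr //=.
congr (_ + _); rewrite -[X in \sum_(X <= _ < _ | _) _]add0n big_addn addKn.
apply: eq_big => [u|u _]; first by rewrite addnC.
congr (r X _); rewrite /exec_count divnDMl // mulnDl addnC.
rewrite -addSn addnC big_addn; rewrite addnK.
by apply: eq_bigr => v _; rewrite addnC.
Qed.

Lemma frame_gt0 : (0 < frame tau)%N.
Proof. by rewrite /frame; elim/big_ind: _ => // m n; rewrite lcmn_gt0 => -> ->. Qed.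

Lemma dvdn_frame X : (tau X %| frame tau)%N.
Proof. by rewrite /frame (bigD1 X) //= dvdn_lcml. Qed.

Lemma tau_le_frame X : (tau X <= frame tau)%N.
Proof. exact: dvdn_leq frame_gt0 (dvdn_frame X). Qed.

Hypothesis r_nonneg : forall X i, (1 <= i <= tau X)%N -> 0 <= r X i.

Lemma exec_count_bounds sched X u : sched u = Some X ->
  (1 <= exec_count tau sched X u <= tau X)%N.
Proof.
move=> su; rewrite /exec_count big_nat_recr ?leq_divM //= su eqxx addn1 /=.
apply: leq_ltn_trans (_ : \sum_(u %/ tau X * tau X <= v < u) 1 < _)%N.
  by apply: leq_sum => v _; case: eqP.
rewrite sum_nat_const_nat muln1.
by have := ltn_pmod u (tau_pos X); have := divn_eq u (tau X); lia.
Qed.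

Lemma total_reward_mono sched X s t : (s <= t)%N ->
  total_reward tau r sched X s <= total_reward tau r sched X t.
Proof.
move=> st; rewrite /total_reward [leRHS](@big_cat_nat _ _ _ s) //= lerDl.
by apply: sumr_ge0 => u /eqP su; apply: r_nonneg; exact: exec_count_bounds.
Qed.

Lemma total_reward_ge0 sched X t : 0 <= total_reward tau r sched X t.
Proof.
apply: le_trans (total_reward_mono sched X (leq0n t)).
by rewrite /total_reward big_geq.
Qed.

Hypothesis r_noninc : forall X i, (1 <= i)%N -> (i < tau X)%N -> r X i.+1 <= r X i.

Local Notation T := (frame tau).

(** From slot [T] on, [insub] fails and the schedule idles. *)
Definition frame_sched (phi : {ffun 'I_T -> S}) : nat -> option S :=
  fun t => omap phi (insub t).

Lemma executions_frame_sched (phi : {ffun 'I_T -> S}) X k :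
  (executions (frame_sched phi) X k =
   \sum_(t : 'I_T) ((phi t == X) && (t %/ tau X == k)))%N.
Proof.
(* Both sides are the sum of [F] over a range containing the period and the frame; [F] vanishes
   outside either. *)
pose F v := ((frame_sched phi v == Some X) && (v %/ tau X == k))%N.
have -> : executions (frame_sched phi) X k = (\sum_(v < k.+1 * tau X + T) F v)%N.
  rewrite -(big_mkord xpredT (fun v => F v : nat)).
  rewrite (@big_cat_nat _ _ _ (k * tau X)) //=; last by nia.
  rewrite (@big_cat_nat _ _ _ (k.+1 * tau X) (k * tau X)) //=; [|nia|nia].
  rewrite [X in (X + _)%N]big_nat [X in (X + _)%N]big1 ?add0n; last first.
    move=> v /andP[_ vk]; rewrite /F [_ == k](_ : _ = false) ?andbF //.
    by apply/negbTE; rewrite neq_ltn ltn_divLR // vk.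
  rewrite [X in (_ + X)%N]big_nat [X in (_ + X)%N]big1 ?addn0; last first.
    move=> v /andP[kv _]; rewrite /F [_ == k](_ : _ = false) ?andbF //.
    by apply/negbTE; rewrite neq_ltn leq_divRL // kv orbT.
  apply: eq_big_nat => v /andP[kv vk]; rewrite /F [_ == k](_ : _ = true) ?andbT //.
  by rewrite eqn_leq -ltnS ltn_divLR // vk leq_divRL.
rewrite -(big_mkord xpredT (fun v => F v : nat)).
rewrite (@big_cat_nat _ _ _ T) //=; last by nia.
rewrite [X in (_ + X)%N]big_nat [X in (_ + X)%N]big1 ?addn0; last first.
  by move=> v /andP[kv _]; rewrite /F /frame_sched insubN // -leqNgt.
by rewrite big_mkord; apply: eq_bigr => t _; rewrite /F /frame_sched valK.
Qed.

Lemma executions_frame_sched_out (phi : {ffun 'I_T -> S}) X k :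
  (T %/ tau X <= k)%N -> executions (frame_sched phi) X k = 0%N.
Proof.
move=> Lk; rewrite /executions big_nat big1 // => v /andP[kv _].
rewrite /frame_sched insubN // -leqNgt; apply: leq_trans kv.
by rewrite -leq_divLR ?dvdn_frame.
Qed.

Lemma card_period X k :
  (\sum_(t : 'I_T) (t %/ tau X == k) = (k < T %/ tau X) * tau X)%N.
Proof.
(* When [X] runs in every slot, its executions count the slots of the period. *)
pose phi : {ffun 'I_T -> S} := [ffun=> X].
have -> : (\sum_(t : 'I_T) (t %/ tau X == k) = executions (frame_sched phi) X k)%N.
  by rewrite executions_frame_sched; apply: eq_bigr => t _; rewrite ffunE eqxx.
case: ltnP => [kL|]; last exact: executions_frame_sched_out.
have kT : (k.+1 * tau X <= T)%N by rewrite -leq_divRL.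
rewrite /executions (eq_big_nat _ _ (F2 := fun=> 1%N)).
  by rewrite sum_nat_const_nat muln1 mulSn addnK mul1n.
move=> v /andP[_ vk]; have vT := leq_trans vk kT.
by rewrite /frame_sched insubT /= ffunE eqxx.
Qed.

Lemma frame_schedule_dominates (f : S -> nat -> R) (d : S -> R) (X0 : S) :
    (forall X, 0 <= d X) ->
    (forall X i, (1 <= i <= tau X)%N -> 0 <= f X i <= T%:R / (tau X)%:R) ->
    \sum_(X : S) \sum_(1 <= i < (tau X).+1) f X i <= T%:R ->
  exists phi : {ffun 'I_T -> S},
    \sum_X d X * (\sum_(1 <= i < (tau X).+1) f X i * r X i) <=
    \sum_X d X * total_reward tau r (frame_sched phi) X T.
Proof.
move=> d_ge0 f_bnd f_sum.
have T0 : (0 : R) < T%:R by rewrite ltr0n frame_gt0.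
have tau0 X : (0 : R) < (tau X)%:R by rewrite ltr0n.
have tauT := tau_le_frame.
(* Nodes are pairs of a task and a period index. The number of periods depends on the task, so
   indices run up to the common bound [T]; the surplus ones receive nothing. *)
pose V := (S * 'I_T)%type.
pose e (t : 'I_T) (v : V) := (t %/ tau v.1 == v.2)%N.
pose w (v : V) i := d v.1 * (if (i < tau v.1)%N then r v.1 i.+1 else 0).
(* The rate [f X i] is spread evenly over the [T / tau X] periods of the frame; the upper bound on
   [f] makes each share at most 1. Units are numbered from 0, rewards from 1. *)
pose z (v : V) i := if (v.2 < T %/ tau v.1)%N && (i < tau v.1)%N
  then f v.1 i.+1 * (tau v.1)%:R / T%:R else 0.
pose x (t : 'I_T) (v : V) : R :=
  (e t v)%:R * (\sum_(1 <= i < (tau v.1).+1) f v.1 i / T%:R).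
have slot_lt (t : 'I_T) X : (t %/ tau X < T)%N.
  exact: leq_ltn_trans (leq_div _ _) (ltn_ord t).
pose s0 : {ffun 'I_T -> V} := [ffun t => (X0, Ordinal (slot_lt t X0))].
have f_ge0 X i : (1 <= i <= tau X)%N -> 0 <= f X i by move=> /f_bnd/andP[].
have [|||||||||s vs] := @assignment_integrality R 'I_T V e w _ _ T z x s0.
- by move=> v i; rewrite /w; case: ifP => // iv; rewrite mulr_ge0 // r_nonneg.
- move=> [X k] i j; elim: j => [|j IHj]; first by rewrite leqn0 => /eqP ->.
  rewrite leq_eqVlt => /predU1P[-> //|/IHj]; apply: le_trans.
  rewrite /w /= ler_wpM2l //; case: ifP => [jX|_].
    by rewrite (ltnW jX) r_noninc.
  by case: ifP => // jX; rewrite r_nonneg.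
- by apply/forallP => t; rewrite ffunE /e /=.
- by rewrite card_ord.
- move=> [X k] i; rewrite /z /=; case: ifP => [/andP[_ iX]|_]; last by rewrite lexx ler01.
  have /andP[f0 f1] := f_bnd X i.+1 iX.
  by rewrite divr_ge0 ?mulr_ge0 //= ler_pdivrMr // mul1r -ler_pdivlMr.
- move=> t [X k]; rewrite /x mulr_ge0 // big_nat sumr_ge0 // => i iX.
  by rewrite divr_ge0 ?f_ge0.
- by move=> t v /negbTE etv; rewrite /x etv mul0r.
- move=> t; rewrite -(pair_bigA _ (fun X k => x t (X, k))) /=.
  rewrite -(@ler_pM2r _ T%:R) // mul1r; apply: le_trans f_sum.
  rewrite mulr_suml; apply: ler_sum => X _.
  rewrite (bigD1 (Ordinal (slot_lt t X))) //= big1 => [|k kt]; last first.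
    by rewrite /x /e /= eq_sym -val_eqE /= in kt *; rewrite (negbTE kt) mul0r.
  by rewrite /x /e /= eqxx addr0 mul1r -mulr_suml divfK // gt_eqF.
- move=> [X k]; have -> : \sum_t x t (X, k) =
      (\sum_(t : 'I_T) (t %/ tau X == k))%:R * (\sum_(1 <= i < (tau X).+1) f X i / T%:R).
    by rewrite natr_sum mulr_suml.
  rewrite card_period natrM.
  rewrite /z /=; case: ltnP => kL; last by rewrite !mul0r big1.
  rewrite -(big_mkord xpredT (fun i => if (i < tau X)%N then f X i.+1 * (tau X)%:R / T%:R else 0)).
  rewrite (sum_pad _ (tauT X)) mul1r mulr_sumr big_add1 /=.
  by apply: eq_bigr => i _; rewrite mulrCA mulrA.
move=> le_val; pose phi := [ffun t => (s t).1].
exists phi.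
have load_s X k : load s (X, k) = executions (frame_sched phi) X k.
  rewrite executions_frame_sched /load; apply: eq_bigr => t _.
  have := forallP vs t; rewrite /phi ffunE; case: (s t) => Y l; rewrite /e /= => /eqP tl.
  by rewrite xpair_eqE -val_eqE /=; case: eqP => //= <-; rewrite tl.
have trE X : total_reward tau r (frame_sched phi) X T =
    \sum_(0 <= k < T %/ tau X) \sum_(1 <= i < (executions (frame_sched phi) X k).+1) r X i.
  by rewrite -total_reward_periods divnK // dvdn_frame.
have valueE : value w s = \sum_X d X * total_reward tau r (frame_sched phi) X T.
  rewrite /value -(pair_bigA _ (fun X k => \sum_(i < load s (X, k)) w (X, k) i)) /=.
  apply: eq_bigr => X _; rewrite trE mulr_sumr.
  pose H k := d X * \sum_(1 <= i < (executions (frame_sched phi) X k).+1) r X i.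
  rewrite (eq_bigr (fun k : 'I_T => H k)) => [|k _]; last first.
    rewrite load_s /H big_add1 /= mulr_sumr big_mkord; apply: eq_bigr => i _.
    by rewrite /w /= (leq_trans (ltn_ord i)) // executions_le.
  rewrite -(big_mkord xpredT H) (@big_cat_nat _ _ _ (T %/ tau X)) ?leq_div //=.
  rewrite [X in _ + X]big_nat [X in _ + X]big1 ?addr0 // => k /andP[Lk _].
  by rewrite /H executions_frame_sched_out // big_geq // mulr0.
rewrite -valueE; apply: le_trans le_val.
rewrite -(pair_bigA _ (fun X k => \sum_(i < T) z (X, k) i * w (X, k) i)) /=.
apply: ler_sum => X _.
(* The fractional value of a single period of [X]; the [T / tau X] periods together cancel the
   factor [tau X / T]. *)
pose c := d X * ((tau X)%:R / T%:R * (\sum_(1 <= i < (tau X).+1) f X i * r X i)).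
rewrite (eq_bigr (fun k : 'I_T => if (k < T %/ tau X)%N then c else 0)) => [|k _]; last first.
  rewrite /z /w /=; case: ltnP => _ /=; last by rewrite big1 // => i _; rewrite mul0r.
  rewrite (eq_bigr (fun i : 'I_T => if (i < tau X)%N
    then f X i.+1 * (tau X)%:R / T%:R * (d X * r X i.+1) else 0)); last first.
    by move=> i _; case: ifP; rewrite ?mul0r.
  rewrite -(big_mkord xpredT (fun i => if (i < tau X)%N
    then f X i.+1 * (tau X)%:R / T%:R * (d X * r X i.+1) else 0)) (sum_pad _ (tauT X)).
  rewrite /c big_add1 /= !mulr_sumr; apply: eq_bigr => i _; ring.
rewrite -(big_mkord xpredT (fun k => if (k < T %/ tau X)%N then c else 0)).
rewrite (sum_pad _ (leq_div _ _)) sumr_const_nat subn0 -mulr_natr /c.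
have -> : T%:R = (T %/ tau X)%:R * (tau X)%:R :> R.
  by rewrite -natrM divnK // dvdn_frame.
have L0 : (T %/ tau X)%:R != 0 :> R.
  by rewrite pnatr_eq0 -lt0n divn_gt0 ?tau_pos // tauT.
have t0 := lt0r_neq0 (tau0 X).
move: (T %/ tau X)%:R L0 => L L0.
by rewrite le_eqVlt; apply/orP; left; apply/eqP; field; rewrite t0 L0.
Qed.
End Frames.

(** * Inferior limits, ultrafilter limits and approachability *)

Lemma le_limn_einfP (R : realType) (u : nat -> R) (l : R) :
  (l%:E <= limn_einf (fun n => (u n)%:E))%E <->
  forall e, 0 < e -> exists N, forall n, (N <= n)%N -> l - e <= u n.
Proof.
rewrite limn_einf_lim (cvg_lim _ (cvg_einfs_sup (u := fun n => (u n)%:E))) //.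
split=> [le_l e e0|le_u].
  have /ereal_sup_gt[_ [N _ <-] ltN] :
      ((l - e)%:E < ereal_sup (range (einfs (fun n => (u n)%:E))))%E.
    by apply: lt_le_trans le_l; rewrite lte_fin ltrBlDr ltrDl.
  exists N => n Nn; rewrite -lee_fin; apply: le_trans (ltW ltN) _.
  by apply: ereal_inf_lbound; exists n.
apply/lee_subgt0Pr => e e0; have [N uN] := le_u e e0.
apply: le_trans (ereal_sup_ubound _); last by exists N.
by apply: le_ereal_inf_tmp => _ [n /= Nn <-]; rewrite lee_fin uN.
Qed.

(** Compactness gives a cluster point, and an ultrafilter converges to any of its cluster points. *)
Lemma ultra_cvg_segment (R : realType) (T : Type) (U : set_system T) (a b : R) (g : T -> R) :
  UltraFilter U -> (forall n, a <= g n <= b) -> exists l : R, (g n @[n --> U] --> l)%classic.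
Proof.
move=> ultraU g_ab; have UF := ultra_proper.
have [|l [_ lcl]] := @segment_compact R a b (g @ U)%classic _.
  by apply: (@filterE _ U _ (g @^-1` `[a, b])%classic) => n /=; rewrite in_itv /=.
exists l => B nB; have [//|UnB] := in_ultra_setVsetC (g @^-1` B)%classic ultraU.
have [y [nBy By]] := lcl (~` B)%classic B UnB nB.
by case: nBy.
Qed.

(* Blackwell approachability of the nonpositive orthant: the squared norm of
   the positive part of the cumulated payoff grows at most linearly. *)
Lemma approachability (R : realType) (S A : finType) (g : A -> S -> R) :
    (forall d : S -> R, (forall X, 0 <= d X) ->
      exists a, \sum_X d X * g a X <= 0) ->
  exists a : nat -> A, forall e, 0 < e -> exists N, forall j, (N <= j)%N ->
    forall X, \sum_(0 <= l < j) g (a l) X <= e * j%:R.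
Proof.
move=> respond.
pose pos (D : S -> R) X := Num.max (D X) 0.
have pos_ge0 D X : 0 <= pos D X by rewrite /pos le_max lexx orbT.
have [Phi PhiP] := choice (fun D => respond (pos D) (pos_ge0 D)).
(* The cumulated payoff when each action responds to the positive part of the current total. *)
pose D j := iteri j (fun _ (Dj : S -> R) X => Dj X + g (Phi Dj) X) (fun=> 0).
pose a j := Phi (D j).
have DE j X : D j X = \sum_(0 <= l < j) g (a l) X.
  elim: j => [|j IHj]; first by rewrite big_geq.
  by rewrite big_nat_recr //= -IHj.
pose C := \sum_b \sum_X g b X ^+ 2.
have gC b : \sum_X g b X ^+ 2 <= C.
  rewrite /C (bigD1 b) //= lerDl; apply: sumr_ge0 => b' _.
  by apply: sumr_ge0 => X _; exact: sqr_ge0.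
(* Summed over [X], the cross term is nonpositive by the choice of the response, so each step adds
   at most [C]. *)
have posD (y z : R) :
    Num.max (y + z) 0 ^+ 2 <= Num.max y 0 ^+ 2 + 2 * (Num.max y 0 * z) + z ^+ 2.
  by case: (leP y 0) => ?; case: (leP (y + z) 0) => ?; nra.
have Vle j : \sum_X pos (D j) X ^+ 2 <= C * j%:R.
  elim: j => [|j IHj].
    by rewrite mulr0 big1 // => X _; rewrite /pos /= maxxx expr0n.
  apply: (@le_trans _ _ (\sum_X (pos (D j) X ^+ 2 +
      2 * (pos (D j) X * g (a j) X) + g (a j) X ^+ 2))).
    by apply: ler_sum => X _; exact: posD.
  rewrite !big_split /= -mulr_sumr -[j.+1%:R]natr1 mulrDr mulr1.
  by have := PhiP (D j); have := gC (a j); rewrite -/(a j); lra.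
have C0 : 0 <= C by apply: sumr_ge0 => b _; apply: sumr_ge0 => X _; exact: sqr_ge0.
(* A coordinate above [e * j] would force [(e * j) ^ 2 < C * j], which fails once [j] exceeds
   [C / e ^ 2]. *)
exists a => e e0; pose N := Num.bound (C / e ^+ 2).
have NP : C / e ^+ 2 < N%:R by apply: archi_boundP; rewrite divr_ge0 ?sqr_ge0.
exists N => j Nj X; rewrite -DE leNgt; apply/negP => ej.
have jN : N%:R <= j%:R :> R by rewrite ler_nat.
move: NP; rewrite ltr_pdivrMr ?exprn_gt0 // => NP.
have : pos (D j) X ^+ 2 <= C * j%:R.
  apply: le_trans (Vle j); rewrite (bigD1 X) //= lerDl.
  by apply: sumr_ge0 => Y _; exact: sqr_ge0.
have j0 : 0 < j%:R :> R.
  apply: lt_le_trans jN; rewrite -(pmulr_lgt0 _ (exprn_gt0 2 e0)).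
  exact: le_lt_trans NP.
have ej0 := mulr_gt0 e0 j0.
rewrite /pos max_l; last by apply: ltW; exact: lt_trans ej.
apply/negP; rewrite -ltNge.
apply: (@lt_trans _ _ ((e * j%:R) ^+ 2)); last by rewrite ltr_pXn2r // nnegrE ltW // (lt_trans ej0).
by rewrite exprMn [j%:R ^+ 2]expr2 mulrA ltr_pM2r //; nra.
Qed.

(** * From rates to a schedule and back *)

Section Theorem4.
Variables (R : realType) (S : finType) (tau : S -> nat).
Variables (r : S -> nat -> R) (qstar : S -> R).
Hypothesis tau_pos : forall X, (0 < tau X)%N.
Local Notation T := (frame tau).

Lemma total_reward_concat (phi : nat -> {ffun 'I_T -> S}) X j :
  total_reward tau r (fun t => frame_sched (phi (t %/ T)%N) (t %% T)%N) X (j * T) =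
  \sum_(0 <= l < j) total_reward tau r (frame_sched (phi l)) X T.
Proof.
have T0 := frame_gt0 tau_pos.
elim: j => [|j IHj]; first by rewrite /total_reward !big_geq.
rewrite big_nat_recr //= -IHj mulSnr total_reward_shift ?dvdn_mull ?dvdn_frame //.
congr (_ + _); apply: eq_total_reward => v vT.
by rewrite divnMDl // modnMDl divn_small // modn_small // addn0.
Qed.

Lemma schedule_of_rates (f : S -> nat -> R) :
    (forall X i, (1 <= i)%N -> (i < tau X)%N -> r X i.+1 <= r X i) ->
    (forall X i, (1 <= i <= tau X)%N -> 0 <= r X i) ->
    (forall X, qstar X <= \sum_(1 <= i < (tau X).+1) f X i * r X i) ->
    (forall X i, (1 <= i <= tau X)%N -> 0 <= f X i <= T%:R / (tau X)%:R) ->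
    \sum_(X : S) \sum_(1 <= i < (tau X).+1) f X i <= T%:R ->
  exists sched, forall X, ((qstar X)%:E <= avg_reward tau r sched X)%E.
Proof.
move=> r_noninc r_nonneg q_le f_bnd f_sum.
case: (pickP (@predT S)) => [X0 _|noS]; last by exists (fun=> None) => X; have := noS X.
have T0 := frame_gt0 tau_pos.
pose q X := \sum_(1 <= i < (tau X).+1) f X i * r X i.
pose g (phi : {ffun 'I_T -> S}) X := q X - total_reward tau r (frame_sched phi) X T.
have respond (d : S -> R) : (forall X, 0 <= d X) -> exists phi, \sum_X d X * g phi X <= 0.
  move=> d_ge0; have [phi phiP] :=
    frame_schedule_dominates tau_pos r_nonneg r_noninc X0 d_ge0 f_bnd f_sum.
  exists phi; under eq_bigr => X _ do rewrite mulrBr.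
  by rewrite sumrB subr_le0.
have [phi phiP] := approachability respond.
pose sched t := frame_sched (phi (t %/ T)%N) (t %% T)%N.
exists sched => X; rewrite /avg_reward; apply/le_limn_einfP => e e0.
have q0 : 0 <= q X.
  rewrite /q big_nat sumr_ge0 // => i iX; rewrite mulr_ge0 ?r_nonneg //.
  by case/andP: (f_bnd X i iX).
have e20 : 0 < e / 2 by rewrite divr_gt0.
(* Half of [e] pays for the approachability error. The other half, over at least [M] frames, pays
   for the reward missing in the incomplete last frame. *)
have [N NP] := phiP _ e20; pose M := Num.bound (q X / (e / 2)).
have MP : q X / (e / 2) < M%:R by apply: archi_boundP; rewrite divr_ge0 // ltW.
exists ((N + M).+1 * T)%N => t tlb; pose j := (t %/ T)%N.
have jlb : ((N + M).+1 <= j)%N by rewrite leq_divRL.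
have jN : (N <= j)%N by lia.
have Mj : M%:R <= j%:R :> R by rewrite ler_nat; lia.
have t0 : (0 < t)%N by apply: leq_trans tlb; rewrite muln_gt0.
have TR0 : 0 < T%:R :> R by rewrite ltr0n.
have tj : t%:R / T%:R <= j%:R + 1 :> R.
  by rewrite ler_pdivrMr // natr1 -natrM ler_nat ltnW // ltn_ceil.
have tT0 : 0 < t%:R / T%:R :> R by rewrite divr_gt0 // ltr0n.
have total_lb : j%:R * (q X - e / 2) <= total_reward tau r sched X t.
  apply: le_trans (total_reward_mono tau_pos r_nonneg _ _ (leq_divM t T)).
  rewrite total_reward_concat; have := NP j jN X.
  by rewrite /g sumrB sumr_const_nat subn0 -mulr_natl; lra.
have total_ge0 := total_reward_ge0 tau_pos r_nonneg sched X t.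
rewrite ler_pdivlMr //; have := q_le X; rewrite -/(q X) => q_leX.
move: MP; rewrite ltr_pdivrMr // => MP.
apply: (@le_trans _ _ ((q X - e) * (t%:R / T%:R))).
  by rewrite ler_pM2r // lerB.
(* Replacing [t / T] by its upper bound [j + 1] requires a positive factor; otherwise nonnegativity
   of the reward suffices. *)
case: (leP (q X - e) 0) => qe.
  by apply: le_trans total_ge0; rewrite pmulr_lle0.
apply: le_trans total_lb.
apply: (@le_trans _ _ ((q X - e) * (j%:R + 1))); first by rewrite ler_pM2l.
by nra.
Qed.

Lemma rates_of_schedule sched :
    (forall X, ((qstar X)%:E <= avg_reward tau r sched X)%E) ->
  exists f : S -> nat -> R,
    [/\ (forall X, qstar X <= \sum_(1 <= i < (tau X).+1) f X i * r X i),
        (forall X i, (1 <= i <= tau X)%N -> 0 <= f X i <= T%:R / (tau X)%:R) &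
        \sum_(X : S) \sum_(1 <= i < (tau X).+1) f X i <= T%:R].
Proof.
move=> q_le; have T0 := frame_gt0 tau_pos.
have N0 n : 0 < n.+1%:R :> R by rewrite ltr0n.
pose K n X := (n.+1 * (T %/ tau X))%N.
have KE n X : (K n X * tau X = n.+1 * T)%N by rewrite -mulnA divnK // dvdn_frame.
pose F n X i : R :=
  (\sum_(0 <= k < K n X) (i <= executions tau sched X k))%N%:R / n.+1%:R.
have F_bnd n X i : 0 <= F n X i <= T%:R / (tau X)%:R.
  rewrite divr_ge0 //= ler_pdivrMr // mulrAC ler_pdivlMr ?ltr0n ?tau_pos //.
  rewrite -!natrM ler_nat [(T * _)%N]mulnC -(KE n X) leq_mul2r; apply/orP; right.
  apply: leq_trans (_ : (\sum_(0 <= k < K n X) 1 <= _)%N).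
    by apply: leq_sum => k _; exact: leq_b1.
  by rewrite sum_nat_const_nat subn0 muln1.
(* Layer-cake counting: a period with [m] executions contributes to the levels [i <= m]. *)
have sum_below (h : nat -> R) m X : (m <= tau X)%N ->
    \sum_(1 <= i < (tau X).+1) (i <= m)%:R * h i = \sum_(1 <= i < m.+1) h i.
  move=> mX; rewrite !big_add1 /= -(sum_pad (fun i => h i.+1) mX).
  by apply: eq_bigr => i _; case: ltnP; rewrite ?mul1r ?mul0r.
have sumFh n X (h : nat -> R) : \sum_(1 <= i < (tau X).+1) F n X i * h i =
    (\sum_(0 <= k < K n X) \sum_(1 <= i < (executions tau sched X k).+1) h i) / n.+1%:R.
  rewrite mulr_suml; under [RHS]eq_bigr => k _ do
    rewrite -(sum_below h _ _ (executions_le _ _ _ _)) mulr_suml.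
  rewrite exchange_big /=; apply: eq_bigr => i _.
  rewrite /F natr_sum -mulr_suml -mulr_suml.
  by rewrite mulrAC.
have F_reward n X : \sum_(1 <= i < (tau X).+1) F n X i * r X i =
    total_reward tau r sched X (n.+1 * T) / n.+1%:R.
  by rewrite sumFh -total_reward_periods // KE.
have F_sum n : \sum_X \sum_(1 <= i < (tau X).+1) F n X i <= T%:R.
  (* With all rewards equal to 1, the total reward counts executions, and each slot hosts at most
     one. *)
  have -> : \sum_X \sum_(1 <= i < (tau X).+1) F n X i =
      (\sum_X total_reward tau (fun _ _ => 1 : R) sched X (n.+1 * T)) / n.+1%:R.
    rewrite mulr_suml; apply: eq_bigr => X _.
    rewrite -(KE n X) total_reward_periods // -(sumFh n X (fun=> 1)).
    by apply: eq_bigr => i _; rewrite mulr1.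
  rewrite ler_pdivrMr // mulrC -natrM /total_reward (exchange_big_dep xpredT) //=.
  rewrite -[leRHS](_ : \sum_(0 <= u < n.+1 * T) 1 = _); last first.
    by rewrite sumr_const_nat subn0.
  apply: ler_sum => u _; case: (sched u) => [Y|]; last by rewrite big_pred0.
  by rewrite (big_pred1 Y) // => X; rewrite /= eq_sym.
(* One ultrafilter refining [\oo] gives the limits for all [X] and [i] at once, and keeps every
   eventual bound. *)
have [U [ultraU ooU]] := ultraFilterLemma (F := \oo%classic) _.
have UF : ProperFilter U by exact: ultra_proper.
have /choice[g gP] (v : S * nat) : exists l : R, (F n v.1 v.2 @[n --> U] --> l)%classic.
  exact: ultra_cvg_segment.
pose f X i := g (X, i).
have fP X i : (F n X i @[n --> U] --> f X i)%classic := gP (X, i).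
have add_cont : continuous (fun x : R * R => x.1 + x.2) := @add_continuous R.
exists f; split.
- move=> X; apply/ler_addgt0Pr => e e0; rewrite -lerBlDr.
  have : (\sum_(1 <= i < (tau X).+1) F n X i * r X i @[n --> U] -->
           \sum_(1 <= i < (tau X).+1) f X i * r X i)%classic.
    by apply: cvg_big => // i _; apply: cvgMr_tmp.
  move=> /cvgr_to_ge; apply; apply: ooU.
  have [N NP] := (le_limn_einfP _ _).1 (q_le X) e e0.
  exists N => // n /= Nn; rewrite F_reward.
  have -> : n.+1%:R = (n.+1 * T)%:R / T%:R :> R.
    by rewrite natrM mulfK // pnatr_eq0 -lt0n.
  by apply: NP; nia.
- move=> X i _; apply/andP; split.
    by apply: cvgr_to_ge (fP X i) _; apply: filterE => n; case/andP: (F_bnd n X i).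
  by apply: cvgr_to_le (fP X i) _; apply: filterE => n; case/andP: (F_bnd n X i).
- have : (\sum_X \sum_(1 <= i < (tau X).+1) F n X i @[n --> U] -->
           \sum_X \sum_(1 <= i < (tau X).+1) f X i)%classic.
    by do 2 apply: cvg_big => // ? _; apply: fP.
  by move=> /cvgr_to_le; apply; apply: filterE.
Qed.
End Theorem4.

Theorem theorem4 (R : realType) (S : finType) (tau : S -> nat)
  (r : S -> nat -> R) (qstar : S -> R)
  (tau_pos : forall X, (0 < tau X)%N)
  (r_noninc : forall X i, (1 <= i)%N -> (i < tau X)%N -> r X i.+1 <= r X i)
  (r_nonneg : forall X i, (1 <= i <= tau X)%N -> 0 <= r X i)
  (qstar_pos : forall X, 0 < qstar X) :
  feasible tau r qstar <->
  exists f : S -> nat -> R,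
    [/\ (forall X, qstar X <= \sum_(1 <= i < (tau X).+1) f X i * r X i),
        (forall X i, (1 <= i <= tau X)%N ->
           0 <= f X i <= (frame tau)%:R / (tau X)%:R) &
        \sum_(X : S) \sum_(1 <= i < (tau X).+1) f X i <= (frame tau)%:R].
Proof.
split; last first.
  move=> [f [q_le f_bnd f_sum]].
  have [sched schedP] := schedule_of_rates tau_pos r_noninc r_nonneg q_le f_bnd f_sum.
  (* A deterministic schedule is a random one on a one-point space. *)
  exists _, unit, (\d_tt : probability _ _), (fun=> sched); split=> //.
  by apply: aeW.
move=> [disp [W [P [sigma [_ [N [mN PN subN]]]]]]].
(* The null set [N] of exceptional outcomes cannot be the whole space, so some outcome gives a
   schedule meeting all requirements. *)
have [omega Nomega] : exists w, ~ N w.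
  apply/existsNP => allN; have := probability_setT P.
  have -> : [set: W]%classic = N by apply/seteqP; split.
  by rewrite PN => /eqP; rewrite eqe eq_sym oner_eq0.
apply: (@rates_of_schedule _ _ _ _ _ tau_pos (sigma omega)).
by apply: contrapT => /subN.
Qed.
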